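(* There exists a consistent atomic RCC8 network over $\{\mathbf{EC}\}$ which has no convex solution in $\mathbb{R}$.
   Context: A region in $\mathbb{R}^n$ ($n\geq 1$) is a nonempty regular closed subset $X$, i.e. $X=\mathrm{cl}(\mathrm{int}(X))$; write $i(X)$ for the interior. The eight RCC8 base relations between regions $a,b$ (jointly exhaustive and pairwise disjoint; $\subset$ denotes proper inclusion) are: $a\,\mathbf{EQ}\,b$: $a=b$; $a\,\mathbf{DC}\,b$: $a\cap b=\emptyset$; $a\,\mathbf{EC}\,b$: $a\cap b\neq\emptyset$ and $i(a)\cap i(b)=\emptyset$; $a\,\mathbf{PO}\,b$: $i(a)\cap i(b)\neq\emptyset$, $a\not\subseteq b$, $b\not\subseteq a$; $a\,\mathbf{TPP}\,b$: $a\subset b$ and $a\not\subset i(b)$; $a\,\mathbf{NTPP}\,b$: $a\subset i(b)$; and the converses $\mathbf{TPP}^{-1}$, $\mathbf{NTPP}^{-1}$ of the last two. Let $V$ be a finite set of variables. An RCC8 constraint is an expression $u\,R\,v$ with $u,v\in V$ distinct and $R$ a nonempty set of base relations; an RCC8 network is a set of such constraints. It is atomic if for every pair of distinct variables $u,v$ it contains a constraint $u\,R\,v$ or $v\,R\,u$ with $R$ a singleton. It is a network over a set $\mathcal{R}$ of base relations if every constraint $u\,R\,v$ in it has $R\subseteq\mathcal{R}$. An $n$-dimensional solution (solution in $\mathbb{R}^n$) of a network is a map $\mathcal{S}$ from $V$ to regions of $\mathbb{R}^n$ such that for each constraint $u\,R\,v$ the base relation holding between $\mathcal{S}(u)$ and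 $\mathcal{S}(v)$ belongs to $R$. A network is consistent if it has a solution in $\mathbb{R}^n$ for some $n\geq 1$ (the regions need not be convex or connected). A solution is convex if every $\mathcal{S}(v)$ is a convex set. *)

(* Defs.v *)
From mathcomp Require Export all_boot all_order all_algebra.
From mathcomp Require Export all_classical all_reals all_analysis.
Export Order.TTheory GRing.Theory Num.Theory numFieldNormedType.Exports.

Set Implicit Arguments.
Unset Strict Implicit.
Unset Printing Implicit Defensive.

Local Open Scope classical_set_scope.
Local Open Scope ring_scope.

Definition region (T : topologicalType) (X : set T) : Prop :=
  X !=set0 /\ regclosed X.

Inductive rcc8 : Type := EQ | DC | EC | PO | TPP | NTPP | TPPi | NTPPi.

(* [`<`] is proper inclusion: the whole space is EQ, not NTPP, to itself. *)
Definition rcc8_holds (T : topologicalType) (r : rcc8) (a b : set T) : Prop :=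
  match r with
  | EQ => a = b
  | DC => a `&` b = set0
  | EC => a `&` b !=set0 /\ a° `&` b° = set0
  | PO => [/\ a° `&` b° !=set0, ~ (a `<=` b) & ~ (b `<=` a)]
  | TPP => a `<` b /\ ~ (a `<` b°)
  | NTPP => a `<` b°
  | TPPi => b `<` a /\ ~ (b `<` a°)
  | NTPPi => b `<` a°
  end.

Record constraint (V : finType) : Type := Constraint {
  lhs : V;
  rhs : V;
  rels : set rcc8;
  lhs_neq_rhs : lhs <> rhs;
  rels_neq0 : rels !=set0
}.

Definition network (V : finType) : Type := set (constraint V).

Definition atomic (V : finType) (N : network V) : Prop :=
  forall u v : V, u <> v ->
    exists2 c : constraint V, N c &
      (lhs c = u /\ rhs c = v \/ lhs c = v /\ rhs c = u) /\
      exists r : rcc8, rels c = [set r].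

Definition network_over (V : finType) (B : set rcc8) (N : network V) : Prop :=
  forall c : constraint V, N c -> rels c `<=` B.

(* R^n is the space of row vectors; its entrywise (product) topology is the
   Euclidean one. *)
Definition solution (V : finType) (N : network V) (R : realType) (n : nat)
    (S : V -> set 'rV[R]_n) : Prop :=
  (forall v : V, region (S v)) /\
  (forall c : constraint V, N c ->
     exists2 r : rcc8, rels c r & rcc8_holds r (S (lhs c)) (S (rhs c))).

Definition consistent (R : realType) (V : finType) (N : network V) : Prop :=
  exists n : nat, (0 < n)%N /\ exists S : V -> set 'rV[R]_n, solution N S.

Definition convex_solution (V : finType) (N : network V) (R : realType)
    (n : nat) (S : V -> set 'rV[R]_n) : Prop :=
  solution N S /\ forall v : V, convex_set (S v).

(* Main.v *)
(* Three pairwise externally connected regions exist in R^3: the closures of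
   the disjoint open cones "the i-th coordinate is the strict maximum" all
   contain the origin. On the line, pick interior points x <= y <= z of three
   convex regions A, B, C that pairwise touch: a point of A `&` C, together with
   x and z, forces y into A or C by convexity, and an interior point of B cannot
   lie in a regular closed set whose interior is disjoint from that of B. *)
Require Import Defs.
From mathcomp Require Import ring lra.

Set Implicit Arguments.
Unset Strict Implicit.
Unset Printing Implicit Defensive.

Local Open Scope classical_set_scope.
Local Open Scope ring_scope.

Lemma open_disjoint_closure (T : topologicalType) (U A : set T) :
  open U -> U `&` A = set0 -> U `&` closure A = set0.
Proof.
move=> oU UA0; rewrite -subset0 => x [Ux /(_ U (open_nbhs_nbhs (conj oU Ux)))].
by rewrite setIC UA0 => -[].
Qed.

(** An open set that misses a set misses its closure. Used twice: [U] misses [closure V], hence also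
    its interior; that interior is open, so it misses [closure U] in turn. *)
Lemma EC_closures (T : topologicalType) (U V : set T) (x : T) :
  open U -> open V -> U `&` V = set0 -> closure U x -> closure V x ->
  rcc8_holds EC (closure U) (closure V).
Proof.
move=> oU oV UV0 Ux Vx; split; first by exists x.
rewrite setIC; apply: (subsetI_eq0 (@subset_refl _ _) (@interior_subset _ _)).
apply: open_disjoint_closure; first exact: open_interior.
rewrite setIC.
apply: (subsetI_eq0 (@subset_refl _ _) (@interior_subset _ _)).
exact: open_disjoint_closure.
Qed.

Definition dominant {R : realType} {n : nat} (i : 'I_n) : set 'rV[R]_n :=
  [set x | forall j, j != i -> x 0 j < x 0 i].

Lemma open_dominant (R : realType) (n : nat) (i : 'I_n) :
  open (dominant i : set 'rV[R]_n).
Proof.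
rewrite openE => x xi; have nbhsF := nbhs_filter x.
(* There are finitely many indices [j], so one neighbourhood of [x] can serve them all. *)
suff : forall j, \forall y \near x, j != i -> (y : 'rV[R]_n) 0 j < y 0 i.
  by move=> /(filter_forall (nbhs_filter x)).
move=> j.
have [->|ji] := eqVneq j i; first exact: (filterE (F := nbhs x)).
have cvg_diff : (y : 'rV[R]_n) 0 j - y 0 i @[y --> x] --> x 0 j - x 0 i.
  by apply: cvgB; exact: coord_continuous.
have : x 0 j - x 0 i < 0 by rewrite subr_lt0 xi.
move=> /(cvgr_lt _ cvg_diff); apply: (filterS (F := nbhs x)) => y /=.
by rewrite subr_lt0 => yji _.
Qed.

Lemma dominant_disjoint (R : realType) (n : nat) (i j : 'I_n) :
  i != j -> dominant i `&` dominant j = set0 :> set 'rV[R]_n.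
Proof.
move=> ij; rewrite -subset0 => x [/(_ j) xi /(_ i ij) xj].
by have := lt_trans (xi _) xj; rewrite ltxx eq_sym => /(_ ij).
Qed.

Lemma closure_dominant0 (R : realType) (n : nat) (i : 'I_n) :
  closure (dominant i : set 'rV[R]_n) 0.
Proof.
(* A short positive multiple of the [i]-th basis vector lies in the cone; the factor [e / 2] keeps
   it strictly inside the ball of radius [e]. *)
move=> B /nbhs_ballP[e /= e0 eB]; exists ((e / 2) *: delta_mx 0 i); split.
  move=> j ji; rewrite !mxE !eqxx (negbTE ji) /= mulr0 mulr1.
  by rewrite divr_gt0.
apply: eB; split=> // k j; rewrite ord1 !mxE eqxx -ball_normE /= sub0r normrN.
case: (j == i); rewrite ?mulr0 ?normr0// mulr1 gtr0_norm ?divr_gt0//.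
by rewrite ltr_pdivrMr// ltr_pMr// ltr1n.
Qed.

Lemma EC_closure_dominant (R : realType) (n : nat) (i j : 'I_n) : i <> j ->
  rcc8_holds EC (closure (dominant i : set 'rV[R]_n)) (closure (dominant j)).
Proof.
move=> /eqP ij; apply: (@EC_closures _ _ _ (0 : 'rV[R]_n)).
- exact: open_dominant.
- exact: open_dominant.
- exact: dominant_disjoint.
- exact: closure_dominant0.
- exact: closure_dominant0.
Qed.

Lemma convex_rV1_between (R : realType) (A : set 'rV[R]_1) (x y z : 'rV[R]_1) :
  convex_set A -> A x -> A z -> x 0 0 <= y 0 0 <= z 0 0 -> A y.
Proof.
move=> cA Ax Az /andP[xy yz].
(* The case where all three points coincide is split off, as the weight below divides by
   [z 0 0 - x 0 0]. *)
have [zx|zx] := leP (z 0 0) (x 0 0).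
  suff -> : y = x by [].
  by apply/rowP => j; rewrite ord1; lra.
have d0 : 0 < z 0 0 - x 0 0 by rewrite subr_gt0.
(* This is the weight of [x] when [y] is written as a convex combination of [x] and [z]. *)
have t0 : 0 <= (z 0 0 - y 0 0) / (z 0 0 - x 0 0).
  by rewrite divr_ge0 ?subr_ge0// ltW.
have t1 : (z 0 0 - y 0 0) / (z 0 0 - x 0 0) <= 1.
  by rewrite ler_pdivrMr// mul1r lerB.
have := cA x z (Itv01 t0 t1) (mem_set Ax) (mem_set Az); rewrite inE.
congr A; apply/rowP => j; rewrite ord1 !mxE /= /unstable.onem.
by field; rewrite gt_eqF.
Qed.

Lemma EC_interior (T : topologicalType) (A B : set T) (y : T) :
  regclosed A -> rcc8_holds EC A B -> B° y -> ~ A y.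
Proof.
move=> rA [_]; rewrite setIC => AB0 By; rewrite -rA => Ay.
have := open_disjoint_closure (open_interior _) AB0.
by rewrite -subset0 => /(_ y); apply.
Qed.

(** The nonempty set [A] is the closure of [A°], and the closure of the empty set is empty. *)
Lemma region_interior (T : topologicalType) (A : set T) :
  region A -> A° !=set0.
Proof.
move=> [[x +] rA]; rewrite -{1}rA => /(_ setT filterT)[y [Ay _]].
by exists y.
Qed.

Lemma convex_rV1_EC_triple (R : realType) (A B C : set 'rV[R]_1)
    (x y z : 'rV[R]_1) :
  regclosed A -> regclosed C -> convex_set A -> convex_set C ->
  rcc8_holds EC A B -> rcc8_holds EC C B -> rcc8_holds EC A C ->
  A x -> B° y -> C z -> x 0 0 <= y 0 0 <= z 0 0 -> False.
Proof.
move=> rA rC cA cC AB CB [[p [Ap Cp]] _] Ax By Cz /andP[xy yz].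
(* The common point [p] of [A] and [C] lies on one side of [y]: either [y] is between [x] and [p],
   both in [A], or between [p] and [z], both in [C]. *)
have [yp|/ltW py] := leP (y 0 0) (p 0 0).
  by apply: (EC_interior rA AB By); apply: convex_rV1_between Ax Ap _ => //;
    rewrite xy yp.
by apply: (EC_interior rC CB By); apply: convex_rV1_between Cp Cz _ => //;
  rewrite py yz.
Qed.

Theorem proposition7 (R : realType) :
  exists (V : finType) (N : network V),
    [/\ consistent R N, atomic N, network_over [set EC] N &
        ~ (exists S : V -> set 'rV[R]_1, convex_solution N S)].
Proof.
have EC_neq0 : [set EC] !=set0 by exists EC.
pose N : network 'I_3 := [set c | rels c = [set EC]].
exists 'I_3, N; split.
(* Dimension 3 gives each variable its own coordinate. *)
- exists 3%N; split=> //; exists (fun i => closure (dominant i)).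
  split=> [i|c Nc].
    split; first by exists 0; exact: closure_dominant0.
    exact/closure_open_regclosed/open_dominant.
  exists EC; first by rewrite Nc.
  exact/EC_closure_dominant/lhs_neq_rhs.
- move=> u v uv; exists (Constraint uv EC_neq0) => //=.
  by split; [left|exists EC].
- by move=> c ->.
- move=> [S [[rS NS] cS]].
  have ec u v : u <> v -> rcc8_holds EC (S u) (S v).
    move=> uv; have [|r /= ->] := NS (Constraint uv EC_neq0); by [].
  have reg v : regclosed (S v) by case: (rS v).
  have [x Sx] := choice (fun i => region_interior (rS i)).
  (* No chosen interior point may lie between the other two, which is impossible for three points on
     a line. *)
  have unordered u v w : u <> v -> w <> v -> u <> w ->
      ~ (x u 0 0 <= x v 0 0 <= x w 0 0).
    move=> uv wv uw; exact: convex_rV1_EC_triple (reg u) (reg w) (cS u) (cS w)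
      (ec _ _ uv) (ec _ _ wv) (ec _ _ uw)
      (interior_subset (Sx u)) (Sx v) (interior_subset (Sx w)).
  pose i0 : 'I_3 := inord 0; pose i1 : 'I_3 := inord 1.
  pose i2 : 'I_3 := inord 2.
  have n01 : i0 <> i1 by move/(congr1 val) => /=; rewrite !inordK.
  have n02 : i0 <> i2 by move/(congr1 val) => /=; rewrite !inordK.
  have n12 : i1 <> i2 by move/(congr1 val) => /=; rewrite !inordK.
  have [n10 n20 n21] : [/\ i1 <> i0, i2 <> i0 & i2 <> i1].
    by split; exact/nesym.
  have h012 := unordered _ _ _ n01 n21 n02.
  have h021 := unordered _ _ _ n02 n12 n01.
  have h102 := unordered _ _ _ n10 n20 n12.
  have h120 := unordered _ _ _ n12 n02 n10.
  have h201 := unordered _ _ _ n20 n10 n21.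
  have h210 := unordered _ _ _ n21 n01 n20.
  (* Each of the eight outcomes, even a cyclic one, contains a chain of two weak inequalities. *)
  case: (leP (x i0 0 0) (x i1 0 0)) (leP (x i1 0 0) (x i2 0 0))
    (leP (x i0 0 0) (x i2 0 0)) => [a|/ltW a] [b|/ltW b] [c|/ltW c];
  by first [ apply: h012; rewrite a b | apply: h021; rewrite c b
           | apply: h102; rewrite a c | apply: h120; rewrite b c
           | apply: h201; rewrite c a | apply: h210; rewrite b a ].
Qed.
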